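(* Let $\mathcal{A}$ be a unital real $C^*$-algebra, $\mathcal{H}$ a real Hilbert space and $\Phi\in\mathrm{UCP}(\mathcal{A},\mathscr{B}(\mathcal{H}))$. If $\Phi$ is pure or multiplicative (i.e. a $*$-homomorphism), then $\Phi\in\mathrm{UCP}_{C^*-ext}(\mathcal{A},\mathscr{B}(\mathcal{H}))$.
   Context: All linear maps are real linear. A real $C^*$-algebra is a real Banach $*$-algebra with $\|a^*a\|=\|a\|^2$ and $1+a^*a$ invertible in the unitization for all $a$. An element is positive if it is of the form $b^*b$. For a real Hilbert space $\mathcal{H}$, $\mathscr{B}(\mathcal{H})$ is the algebra of bounded real linear operators. A real linear $\Phi:\mathcal{A}\to\mathscr{B}(\mathcal{H})$ is completely positive (CP) if $\sum_{i,j=1}^nT_i^*\Phi(a_i^*a_j)T_j\ge0$ for all finite families $a_j\in\mathcal{A}$, $T_j\in\mathscr{B}(\mathcal{H})$. $\mathrm{UCP}(\mathcal{A},\mathscr{B}(\mathcal{H}))$ is the set of CP maps with $\Phi(1)=I$. $\mathrm{Ad}_T(X)=T^*XT$. $\Phi\in\mathrm{UCP}(\mathcal{A},\mathscr{B}(\mathcal{H}))$ is a $C^*$-extreme point (written $\Phi\in\mathrm{UCP}_{C^*-ext}(\mathcal{A},\mathscr{B}(\mathcal{H}))$) if whenever $\Phi=\sum_{j=1}^n\mathrm{Ad}_{T_j}\circ\Phi_j$ with $\Phi_j\in\mathrm{UCP}(\mathcal{A},\mathscr{B}(\mathcal{H}))$ and invertible $T_j\in\mathscr{B}(\mathcal{H})$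 satisfying $\sum_jT_j^*T_j=I$, then for every $j$ there is a unitary $U_j\in\mathscr{B}(\mathcal{H})$ with $\Phi_j=\mathrm{Ad}_{U_j}\circ\Phi$. A CP map $\Phi:\mathcal{A}\to\mathscr{B}(\mathcal{H})$ is pure if every CP map $\Psi:\mathcal{A}\to\mathscr{B}(\mathcal{H})$ for which $\Phi-\Psi$ is CP is of the form $\Psi=t\Phi$ with $t\in[0,1]$.
   Formalization: Complete positivity is taken to include Φ(a* )=Φ(a)*, which is automatic unless dim H=1; without it the claim fails for A=R×C, H=R, Φ(r,z)=r, the average of the unital ''CP'' maps r±Im z. *)

(* Defs.v *)
From HB Require Import structures.
From mathcomp Require Import all_boot all_order all_algebra.
From mathcomp Require Import all_classical all_reals all_analysis.
From mathcomp Require Import ring lra.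

Set Implicit Arguments.
Unset Strict Implicit.
Unset Printing Implicit Defensive.
Import Order.TTheory GRing.Theory Num.Theory.
Import numFieldNormedType.Exports.

Local Open Scope classical_set_scope.
Local Open Scope ring_scope.

(* Unital real C*-algebras. The product is a field of the mixin because the
   hierarchy does not allow a structure that joins its rings with its normed
   spaces. The zero algebra is not excluded. For unital A, 1 + a^* a is
   invertible in A iff it is invertible in the unitization of A, the latter
   being isomorphic to the product of A and R. *)
HB.mixin Record isRealCStarAlgebra (R : realType) A
    of CompleteNormedModule R A := {
  cmul : A -> A -> A;
  cone : A;
  star : A -> A;
  cmulA : associative cmul;
  cmul1 : left_id cone cmul;
  cmulr1 : right_id cone cmul;
  cmul_linearl : forall y, linear (cmul ^~ y);
  cmul_linearr : forall x, linear (cmul x);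
  star_linear : linear star;
  starK : involutive star;
  starM : forall x y, star (cmul x y) = cmul (star y) (star x);
  normM_le : forall x y, `|cmul x y| <= `|x| * `|y|;
  cstar_norm : forall x, `|cmul (star x) x| = `|x| ^+ 2;
  cstar_invertible : forall x, exists y,
    cmul y (cone + cmul (star x) x) = cone /\
    cmul (cone + cmul (star x) x) y = cone
}.

#[short(type="realCStarAlgType")]
HB.structure Definition RealCStarAlgebra (R : realType) :=
  {A of CompleteNormedModule R A & isRealCStarAlgebra R A}.

Arguments cone {R s}.

HB.mixin Record isRealHilbert (R : realType) H
    of CompleteNormedModule R H := {
  inner : H -> H -> R;
  inner_linear : forall y, linear_for *%R (inner ^~ y);
  innerC : forall x y, inner x y = inner y x;
  inner_norm : forall x, inner x x = `|x| ^+ 2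
}.

#[short(type="realHilbertType")]
HB.structure Definition RealHilbert (R : realType) :=
  {H of CompleteNormedModule R H & isRealHilbert R H}.

Section InnerProduct.
Context (R : realType) (H : realHilbertType R).
Implicit Types (x y z : H) (k : R).

Lemma innerDl x y z : inner (x + y) z = inner x z + inner y z.
Proof. by have := inner_linear z 1 x y; rewrite scale1r mul1r. Qed.

Lemma inner0l z : inner (0 : H) z = 0.
Proof. by apply: (addrI (inner (0 : H) z)); rewrite -innerDl !addr0. Qed.

Lemma innerZl k x z : inner (k *: x) z = k * inner x z.
Proof. by have := inner_linear z k x 0; rewrite inner0l !addr0. Qed.

Lemma innerNl x z : inner (- x) z = - inner x z.
Proof. by rewrite -scaleN1r innerZl mulN1r. Qed.

Lemma innerBl x y z : inner (x - y) z = inner x z - inner y z.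
Proof. by rewrite innerDl innerNl. Qed.

Lemma innerDr x y z : inner z (x + y) = inner z x + inner z y.
Proof. by rewrite innerC innerDl !(innerC z). Qed.

Lemma inner0r z : inner z (0 : H) = 0.
Proof. by rewrite innerC inner0l. Qed.

Lemma innerZr k x z : inner z (k *: x) = k * inner z x.
Proof. by rewrite innerC innerZl (innerC z). Qed.

Lemma innerNr x z : inner z (- x) = - inner z x.
Proof. by rewrite innerC innerNl (innerC z). Qed.

Lemma innerBr x y z : inner z (x - y) = inner z x - inner z y.
Proof. by rewrite innerDr innerNr. Qed.

Lemma inner_ge0 x : 0 <= inner x x.
Proof. by rewrite inner_norm exprn_ge0. Qed.

Lemma inner_eq0 x : inner x x = 0 -> x = 0.
Proof. by rewrite inner_norm => /eqP; rewrite expf_eq0 normr_eq0 => /eqP. Qed.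

Lemma inner_ext x y : (forall z, inner x z = inner y z) -> x = y.
Proof.
move=> xy; apply/subr0_eq/inner_eq0.
by rewrite innerBl xy subrr.
Qed.

Lemma cauchy_schwarz x y : `|inner x y| <= `|x| * `|y|.
Proof.
have [->|y0] := eqVneq y 0; first by rewrite inner0r !normr0 mulr0.
have n0 : 0 < `|y| ^+ 2 by rewrite exprn_gt0 // normr_gt0.
have := inner_ge0 (`|y| ^+ 2 *: x - inner x y *: y).
rewrite !(innerBl, innerBr, innerZl, innerZr) (innerC y x) !inner_norm.
set a := `|x|; set b := `|y|; set c := inner x y => h.
have {}h : 0 <= b ^+ 2 * ((a * b) ^+ 2 - c ^+ 2).
  by move: h; lra.
move: h; rewrite pmulr_rge0 // subr_ge0 -[c ^+ 2]real_normK ?num_real //.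
by rewrite ler_pXn2r ?nnegrE ?mulr_ge0 ?normr_ge0.
Qed.

End InnerProduct.

Section Riesz.
Context (R : realType) (H : realHilbertType R).

Theorem riesz (f : H -> R) (M : R) :
  linear_for *%R f -> (forall x, `|f x| <= M * `|x|) ->
  exists y : H, forall x, f x = inner y x.
Proof.
move=> flin fM.
have fD x y : f (x + y) = f x + f y by have := flin 1 x y; rewrite scale1r mul1r.
have f0 : f 0 = 0 by apply: (addrI (f 0)); rewrite -fD !addr0.
have fZ k x : f (k *: x) = k * f x by have := flin k x 0; rewrite f0 !addr0.
pose J (x : H) : R := inner x x - 2 * f x.
pose E : set R := [set J x | x in setT].
have lbE : lbound E (- M ^+ 2).
  move=> _ [x _ <-]; rewrite /J inner_norm.
  have := fM x; rewrite ler_norml => /andP[_].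
  by have := sqr_ge0 (`|x| - M); nra.
have infE : has_inf E by split; [exists (J 0); exists 0 | exists (- M ^+ 2)].
pose m := inf E.
have mJ x : m <= J x by apply: ge_inf; [exists (- M ^+ 2) | exists x].
have Jm (e : R) : 0 < e -> exists x, J x < m + e.
  by move=> e0; have [_ [x _ <-] h] := inf_adherent e0 infE; exists x.
pose d (n : nat) : R := n.+1%:R^-1.
have d0 n : 0 < d n by rewrite invr_gt0.
have /choice[x xP] (n : nat) : exists x, J x < m + d n ^+ 2.
  by apply: Jm; rewrite exprn_gt0.
have xB n k : (n <= k)%N -> `|x n - x k| <= 2 * d n.
  move=> nk; have dkn : d k <= d n by rewrite lef_pV2 ?posrE // ler_nat.
  rewrite -(@ler_pXn2r _ 2) ?nnegrE ?mulr_ge0 ?(ltW (d0 n)) //.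
  rewrite -(inner_norm (x n - x k)).
  have := mJ (2^-1 *: (x n + x k)); have := xP n; have := xP k; rewrite /J.
  rewrite !(innerBl, innerBr, innerZl, innerZr, innerDl, innerDr) fZ fD.
  rewrite (innerC (x k) (x n)) => h1 h2 h3.
  have : d k ^+ 2 <= d n ^+ 2 by rewrite ler_pXn2r // ?nnegrE ?(ltW (d0 _)).
  by rewrite exprMn; lra.
have xc : cvg (x @ \oo).
  apply: cauchy_cvg; apply: cauchy_exP => e e0.
  have e20 : 0 < e / 2 by rewrite divr_gt0.
  have [N _ NP] := near_infty_natSinv_lt (PosNum e20).
  exists (x N); exists N => // n /= Nn.
  rewrite -ball_normE /=; apply: (le_lt_trans (xB _ _ Nn)).
  have dN : d N < e / 2 := NP N (leqnn N).
  by lra.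
exists (lim (x @ \oo)) => h; set y := lim _.
have fx n : `|inner (x n) h - f h| <= d n * (`|h| ^+ 2 + 1).
  have dn := d0 n.
  have := mJ (x n + d n *: h); have := mJ (x n + (- d n) *: h).
  have := xP n; rewrite /J.
  rewrite !(innerDl, innerDr, innerZl, innerZr) !fD !fZ (innerC h (x n)).
  rewrite (inner_norm h) => h1 h2 h3.
  set a := inner (x n) h in h1 h2 h3 *; set b := `|h| ^+ 2 in h1 h2 h3 *.
  have b0 : 0 <= b by rewrite exprn_ge0.
  have k1 : 0 <= d n * (d n * (b + 1) + 2 * (a - f h)) by nra.
  have k2 : 0 <= d n * (d n * (b + 1) - 2 * (a - f h)) by nra.
  rewrite pmulr_rge0 // in k1; rewrite pmulr_rge0 // in k2.
  have k3 : 0 <= d n * (b + 1) by rewrite mulr_ge0 ?addr_ge0 // ltW.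
  by rewrite ler_norml; apply/andP; split; lra.
apply/eqP; rewrite eq_sym -subr_eq0 -normr_le0; apply/ler_addgt0Pr => e e0.
rewrite add0r.
pose c := `|h| ^+ 2 + 1 + `|h|.
have c0 : 0 < c by rewrite /c ltr_wpDr // ltr_wpDl // exprn_ge0.
have ec0 : 0 < e / c by rewrite divr_gt0.
have /cvgrPdist_lt/(_ _ ec0) [N1 _ N1P] : x @ \oo --> y by [].
have [N2 _ N2P] := near_infty_natSinv_lt (PosNum ec0).
pose n := maxn N1 N2.
have /N1P yx : (N1 <= n)%N by rewrite leq_maxl.
have /N2P /= dn : (N2 <= n)%N by rewrite leq_maxr.
rewrite -/(d n) in dn.
have -> : inner y h - f h = inner (y - x n) h + (inner (x n) h - f h).
  by rewrite innerBl; ring.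
apply: (le_trans (ler_normD _ _)).
have A1 : `|inner (y - x n) h| <= e / c * `|h|.
  by apply: (le_trans (cauchy_schwarz _ _)); rewrite ler_wpM2r // ltW.
have A2 : `|inner (x n) h - f h| <= e / c * (`|h| ^+ 2 + 1).
  apply: (le_trans (fx n)); rewrite ler_wpM2r ?addr_ge0 ?exprn_ge0 //.
  exact: ltW.
apply: (le_trans (lerD A1 A2)).
by rewrite -mulrDr [X in _ * X](_ : _ = c) ?divfK ?gt_eqF // /c; ring.
Qed.

End Riesz.

Section BoundedOperators.
Context (R : realType) (H : realHilbertType R).

Definition bounded_linear : {pred H -> H} := fun f =>
  `[< linear f /\ exists M : R, forall x, `|f x| <= M * `|x| >].

Record bounded_op := BoundedOp {
  op_fun :> H -> H;
  op_fun_bounded : op_fun \in bounded_linear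
}.

HB.instance Definition _ := [isSub for op_fun].
HB.instance Definition _ := [Choice of bounded_op by <:].

Lemma bounded_linear_submod : subsemimod_closed bounded_linear.
Proof.
split; [split|].
- apply/asboolP; split; first by move=> k x y; rewrite scaler0 addr0.
  by exists 0 => x; rewrite normr0 mul0r.
- move=> f g /asboolP[fl [M fM]] /asboolP[gl [N gN]]; apply/asboolP; split.
    by move=> k x y; rewrite !fctE fl gl scalerDr addrACA.
  exists (M + N) => x; rewrite mulrDl; apply: (le_trans (ler_normD _ _)).
  exact: lerD.
- move=> c f /asboolP[fl [M fM]]; apply/asboolP; split.
    by move=> k x y; rewrite !fctE fl scalerDr !scalerA mulrC.
  by exists (`|c| * M) => x; rewrite !fctE normrZ -mulrA ler_wpM2l.
Qed.

HB.instance Definition _ :=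
  GRing.SubChoice_isSubLmodule.Build R (H -> H) bounded_linear bounded_op
    bounded_linear_submod.

Lemma opP (f g : bounded_op) : (forall x, f x = g x) -> f = g.
Proof. by move=> fg; apply/val_inj/funext. Qed.

Lemma op_linear (f : bounded_op) : linear f.
Proof. by have /asboolP[] := op_fun_bounded f. Qed.

Lemma op_bounded (f : bounded_op) : exists M : R, forall x, `|f x| <= M * `|x|.
Proof. by have /asboolP[] := op_fun_bounded f. Qed.

Lemma op_bounded_ge0 (f : bounded_op) :
  exists2 M : R, 0 <= M & forall x, `|f x| <= M * `|x|.
Proof.
have [M fM] := op_bounded f; exists `|M| => // x.
by apply: (le_trans (fM x)); rewrite ler_wpM2r // ler_norm.
Qed.

Lemma opD (f : bounded_op) x y : f (x + y) = f x + f y.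
Proof. by have := op_linear f 1 x y; rewrite !scale1r. Qed.

Lemma op0 (f : bounded_op) : f 0 = 0.
Proof. by apply: (addrI (f 0)); rewrite -opD !addr0. Qed.

Lemma opZ (f : bounded_op) (k : R) x : f (k *: x) = k *: f x.
Proof. by have := op_linear f k x 0; rewrite op0 !addr0. Qed.

Lemma id_bounded_linear : (id : H -> H) \in bounded_linear.
Proof. by apply/asboolP; split=> //; exists 1 => x; rewrite mul1r. Qed.

Lemma comp_bounded_linear (f g : bounded_op) :
  (fun x => f (g x)) \in bounded_linear.
Proof.
apply/asboolP; split; first by move=> k x y; rewrite !op_linear.
have [M M0 fM] := op_bounded_ge0 f; have [N gN] := op_bounded g.
exists (M * N) => x; apply: (le_trans (fM _)).
by rewrite -mulrA ler_wpM2l.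
Qed.

Definition op_id := BoundedOp id_bounded_linear.
Definition op_comp (f g : bounded_op) := BoundedOp (comp_bounded_linear f g).

Fact op_compA : associative op_comp.
Proof. by move=> f g h; apply: opP. Qed.
Fact op_comp1l : left_id op_id op_comp.
Proof. by move=> f; apply: opP. Qed.
Fact op_comp1r : right_id op_id op_comp.
Proof. by move=> f; apply: opP. Qed.
Fact op_compDl : left_distributive op_comp +%R.
Proof. by move=> f g h; apply: opP. Qed.
Fact op_compDr : right_distributive op_comp +%R.
Proof. by move=> f g h; apply: opP => x /=; rewrite opD. Qed.

HB.instance Definition _ := GRing.Zmodule_isPzRing.Build bounded_op
  op_compA op_comp1l op_comp1r op_compDl op_compDr.

Lemma op_adjoint (f : bounded_op) :
  exists g : bounded_op, forall x y, inner (f x) y = inner x (g y).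
Proof.
have [M M0 fM] := op_bounded_ge0 f.
have /choice[g gP] (y : H) : exists z, forall x, inner (f x) y = inner z x.
  apply: (@riesz _ _ _ (M * `|y|)) => [k u v|x].
    by rewrite op_linear innerDl innerZl.
  apply: (le_trans (cauchy_schwarz _ _)).
  by rewrite mulrAC ler_wpM2r.
suff gb : g \in bounded_linear.
  by exists (BoundedOp gb) => x y; rewrite gP innerC.
apply/asboolP; split.
  move=> k u v; apply: inner_ext => z.
  by rewrite innerDl innerZl -!gP innerDr innerZr.
exists M => x; have [->|gx0] := eqVneq (g x) 0.
  by rewrite normr0 mulr_ge0.
rewrite -(@ler_pM2r _ `|g x|) ?normr_gt0 // -expr2 -inner_norm -gP.
apply: (le_trans (ler_norm _)); apply: (le_trans (cauchy_schwarz _ _)).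
by rewrite mulrAC ler_wpM2r.
Qed.

Definition adjoint (f : bounded_op) : bounded_op := projT1 (cid (op_adjoint f)).

Lemma adjointP (f : bounded_op) x y : inner (f x) y = inner x (adjoint f y).
Proof. exact: (projT2 (cid (op_adjoint f))). Qed.

Lemma adjoint_unique (f g : bounded_op) :
  (forall x y, inner (f x) y = inner x (g y)) -> adjoint f = g.
Proof.
move=> fg; apply: opP => y; apply: inner_ext => x.
by rewrite innerC -adjointP fg innerC.
Qed.

Lemma adjoint_linear : linear adjoint.
Proof.
move=> k f g; apply: adjoint_unique => x y.
rewrite (_ : (k *: f + g) x = k *: f x + g x) //.
rewrite (_ : (k *: adjoint f + adjoint g) y = k *: adjoint f y + adjoint g y) //.
by rewrite innerDl innerZl innerDr innerZr !adjointP.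
Qed.

Lemma adjointK : involutive adjoint.
Proof.
by move=> f; apply: adjoint_unique => x y; rewrite innerC -adjointP innerC.
Qed.

Lemma adjointM (f g : bounded_op) : adjoint (f * g) = adjoint g * adjoint f.
Proof.
apply: adjoint_unique => x y.
by rewrite -[RHS]/(inner x (adjoint g (adjoint f y))) -!adjointP.
Qed.

Definition invertible (T : bounded_op) :=
  exists S : bounded_op, S * T = 1 /\ T * S = 1.

Definition unitary (U : bounded_op) :=
  adjoint U * U = 1 /\ U * adjoint U = 1.

Definition positive (T : bounded_op) :=
  exists S : bounded_op, T = adjoint S * S.

Definition Ad (T X : bounded_op) : bounded_op := adjoint T * X * T.

End BoundedOperators.

Section CompletelyPositive.
Context (R : realType) (A : realCStarAlgType R) (H : realHilbertType R).
Local Notation BH := (bounded_op H).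
Implicit Types Phi Psi : {linear A -> BH}.

Definition cp_sums Phi :=
  forall (n : nat) (a : 'I_n -> A) (T : 'I_n -> BH),
    positive
      (\sum_i \sum_j adjoint (T i) * Phi (cmul (star (a i)) (a j)) * T j).

(* The first clause is part of complete positivity in the usual, matricial
   sense. It follows from the second one unless dim H = 1 (see
   [cp_sums_adjoint] below). For H = R, where the second clause only says that
   Phi (b^* b) >= 0, it has to be required: otherwise
   (r, z) |-> r + Im z would be completely positive on the product of R and C,
   and (r, z) |-> r would be the average of two such maps. *)
Definition cp Phi :=
  (forall a : A, Phi (star a) = adjoint (Phi a)) /\ cp_sums Phi.

Definition ucp Phi := cp Phi /\ Phi cone = 1.

Definition pure Phi :=
  cp Phi /\
  forall Psi, cp Psi -> cp (Phi \- Psi) ->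
    exists2 t : R, 0 <= t <= 1 & forall a : A, Psi a = t *: Phi a.

Definition star_hom Phi :=
  (forall a b : A, Phi (cmul a b) = Phi a * Phi b) /\
  (forall a : A, Phi (star a) = adjoint (Phi a)).

Definition cstar_extreme Phi :=
  ucp Phi /\
  forall (n : nat) (Phis : 'I_n -> {linear A -> BH}) (T : 'I_n -> BH),
    (forall j, ucp (Phis j)) ->
    (forall j, invertible (T j)) ->
    \sum_j adjoint (T j) * T j = 1 ->
    (forall a : A, Phi a = \sum_j Ad (T j) (Phis j a)) ->
    forall j, exists2 U : BH, unitary U &
      forall a : A, Phis j a = Ad U (Phi a).

Lemma positive_selfadj (T : BH) : positive T -> adjoint T = T.
Proof. by move=> [S ->]; rewrite adjointM adjointK. Qed.

Lemma star_cone : star cone = cone :> A.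
Proof. by rewrite -[RHS]starK -[star cone in RHS]cmul1 starM starK cmul1. Qed.

Lemma cp_sums_adjoint Phi (u v : H) :
  u != 0 -> v != 0 -> inner u v = 0 -> cp_sums Phi ->
  forall a : A, Phi (star a) = adjoint (Phi a).
Proof.
move=> u0 v0 uv cpP a.
have adjD (S T : BH) : adjoint (S + T) = adjoint S + adjoint T.
  by have := @adjoint_linear R H 1 S T; rewrite !scale1r.
have adjN (S : BH) : adjoint (- S) = - adjoint S.
  apply: (addrI (adjoint S)); rewrite -adjD !subrr.
  by apply: (addrI (adjoint 0)); rewrite -adjD !addr0.
have rk (p q : H) : (fun x => inner x p *: q) \in @bounded_linear R H.
  apply/asboolP; split.
    by move=> k x y; rewrite innerDl innerZl scalerDl scalerA.
  exists (`|p| * `|q|) => x; rewrite normrZ mulrAC ler_wpM2r //.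
  by rewrite mulrC cauchy_schwarz.
pose D : BH := Phi a - adjoint (Phi (star a)).
have sumS (T : BH) : D * T = adjoint (D * T).
  have h1 (b : A) (S : BH) :
      adjoint (adjoint S * Phi (cmul (star b) b) * S)
      = adjoint S * Phi (cmul (star b) b) * S.
    have := cpP 1%N (fun=> b) (fun=> S); rewrite !big_ord1.
    by move/positive_selfadj.
  have := cpP 2%N (fun i => if i == 0 then cone else a)
                  (fun i => if i == 0 then 1 else T).
  rewrite !big_ord_recl !big_ord0 /= => /positive_selfadj.
  have := h1 a T; have := h1 cone 1.
  have adj1 : adjoint 1 = 1 :> BH by apply: adjoint_unique.
  rewrite adj1 !star_cone !mul1r !mulr1 !addr0 !cmul1 cmulr1.
  set X := adjoint T * Phi (cmul _ _) * T => h0 hX.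
  rewrite !adjD h0 hX -!addrA => /addrI; rewrite !addrA => /addIr.
  rewrite !adjointM !adjointK => h.
  have {}h : Phi a * T =
      adjoint T * adjoint (Phi a) + adjoint (Phi (star a)) * T
      - adjoint T * Phi (star a) by rewrite h addrK.
  rewrite /D adjD adjN adjointK mulrBl mulrBr h [LHS]addrAC addrK.
  by [].
have {}sumS p q x y :
    inner x p * inner (D q) y = inner y p * inner (D q) x.
  have [T TE] : exists T : BH, forall z, T z = inner z p *: q.
    by exists (BoundedOp (rk p q)).
  have := adjointP (D * T) x y; rewrite -sumS.
  rewrite -[(D * T) x]/(D (T x)) -[(D * T) y]/(D (T y)) !TE !opZ.
  by rewrite innerZl innerZr (innerC (D q) x).
have D0 q : D q = 0.
  apply: inner_ext => y; rewrite inner0l.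
  have perp p z : p != 0 -> inner z p = 0 -> inner (D q) z = 0.
    move=> p0 zp; have := sumS p q p z; rewrite zp mul0r => /eqP.
    rewrite mulf_eq0 => /orP[/eqP/inner_eq0 p0'|/eqP//].
    by rewrite p0' eqxx in p0.
  have uu0 : inner u u != 0 by apply/eqP => /inner_eq0 /eqP; apply/negP.
  have -> : y = (y - (inner y u / inner u u) *: u) + (inner y u / inner u u) *: u.
    by rewrite subrK.
  rewrite innerDr innerZr (perp u) // ?(perp v) ?mulr0 ?addr0 //.
  by rewrite innerBl innerZl divfK ?subrr.
have /eqP : D = 0 by apply: opP.
by rewrite subr_eq0 => /eqP ->; rewrite adjointK.
Qed.

End CompletelyPositive.

(* Main.v *)
Require Import Defs.
From HB Require Import structures.
From mathcomp Require Import all_boot all_order all_algebra.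
From mathcomp Require Import all_classical all_reals all_analysis.
From mathcomp Require Import ring lra.

(** If [Phi] is pure, each summand [Ad T_j \o Phi_j] is a multiple [t Phi], and
    its value at [1] shows that [T_j / sqrt t] is unitary. If [Phi] is
    multiplicative, then [Phi (a^* a) = Phi a^* Phi a] forces equality in the
    Kadison-Schwarz inequalities of the [Phi_j], hence [Phi_j a T_j = T_j Phi a].
    Therefore [Phi a] commutes with [T_j^* T_j] and with its square root, and the
    unitary part of the polar decomposition of [T_j] intertwines [Phi] and
    [Phi_j]. *)

Set Implicit Arguments.
Unset Strict Implicit.
Unset Printing Implicit Defensive.
Import Order.TTheory GRing.Theory Num.Theory.
Import numFieldNormedType.Exports.

Local Open Scope classical_set_scope.
Local Open Scope ring_scope.

(** * Algebra of bounded operators: evaluation, adjoints, conjugation *)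

Section OperatorAlgebra.
Context (R : realType) (H : realHilbertType R).
Local Notation BH := (bounded_op H).
Implicit Types (f g S T U : BH) (k : R) (x y : H).

Lemma opB f x y : f (x - y) = f x - f y.
Proof. by rewrite opD -scaleN1r opZ scaleN1r. Qed.

Lemma add_opE f g x : (f + g) x = f x + g x. Proof. by []. Qed.
Lemma opp_opE f x : (- f) x = - f x. Proof. by []. Qed.
Lemma scale_opE k f x : (k *: f) x = k *: f x. Proof. by []. Qed.
Lemma mul_opE f g x : (f * g) x = f (g x). Proof. by []. Qed.
Lemma one_opE x : (1 : BH) x = x. Proof. by []. Qed.
Lemma zero_opE x : (0 : BH) x = 0. Proof. by []. Qed.

Lemma sum_opE (I : Type) (r : seq I) (P : pred I) (F : I -> BH) x :
  (\sum_(i <- r | P i) F i) x = \sum_(i <- r | P i) F i x.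
Proof. exact: (big_morph (fun f : BH => f x)). Qed.

Lemma scale_opMl k f g : (k *: f) * g = k *: (f * g).
Proof. exact: opP. Qed.

Lemma scale_opMr k f g : f * (k *: g) = k *: (f * g).
Proof. by apply: opP => x; rewrite mul_opE !scale_opE opZ. Qed.

Lemma adjoint_inner f x y : inner (adjoint f x) y = inner x (f y).
Proof. by rewrite innerC -adjointP innerC. Qed.

HB.instance Definition _ :=
  GRing.isLinear.Build R BH BH *:%R (@adjoint R H) (@adjoint_linear R H).

Lemma adjoint1 : adjoint 1 = 1 :> BH.
Proof. exact: adjoint_unique. Qed.

Lemma inner_suml (I : Type) (r : seq I) (P : pred I) (F : I -> H) y :
  inner (\sum_(i <- r | P i) F i) y = \sum_(i <- r | P i) inner (F i) y.
Proof.
by apply: (big_morph (fun x => inner x y)) => [u v|]; rewrite ?innerDl ?inner0l.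
Qed.

(** A left inverse of an invertible operator is its two-sided inverse. *)
Lemma isometry_unitary U : adjoint U * U = 1 -> invertible U -> unitary U.
Proof.
move=> UU [V [_ UV]]; split=> //.
by rewrite -[adjoint U]mulr1 -{1}UV !mulrA -(mulrA U) UU mulr1.
Qed.

Lemma unitary_adjoint U : unitary U -> unitary (adjoint U).
Proof. by move=> [UU UU']; split; rewrite adjointK. Qed.

(** Needed to see [Ad T \o Phi] as a linear map, the type on which [cp] is defined. *)
Lemma Ad_linear T : linear (Ad T).
Proof.
by move=> k f g; rewrite /Ad mulrDr mulrDl scale_opMr scale_opMl.
Qed.

HB.instance Definition _ T :=
  GRing.isLinear.Build R BH BH *:%R (Ad T) (Ad_linear T).

Lemma adjoint_Ad T f : adjoint (Ad T f) = Ad T (adjoint f).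
Proof. by rewrite /Ad !adjointM adjointK mulrA. Qed.

End OperatorAlgebra.

(** * Strong operator convergence *)

Section SquareRoot.
Context (R : realType) (H : realHilbertType R).
Local Notation BH := (bounded_op H).
Implicit Types (f g S T : BH) (k : R) (x y : H).

Lemma norm_le_cvg0 (u : nat -> H) (v : nat -> R) x :
  (forall n, `|u n - x| <= v n) -> v @ \oo --> (0 : R) -> u @ \oo --> x.
Proof.
move=> uv v0; apply/cvgrPdist_lt => e e0.
move/cvgrPdist_lt/(_ _ e0): v0; apply: filterS => n.
rewrite sub0r normrN distrC => vn.
by apply: (le_lt_trans (uv n)); apply: le_lt_trans vn; exact: ler_norm.
Qed.

Lemma norm_sub_cvg (u : nat -> H) x :
  u @ \oo --> x -> (fun n => `|u n - x|) @ \oo --> (0 : R).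
Proof.
move=> ux; rewrite -(normr0 H) -(subrr x).
by apply: cvg_norm; apply: cvgB => //; exact: cvg_cst.
Qed.

Lemma op_cvg f (u : nat -> H) x :
  u @ \oo --> x -> (fun n => f (u n)) @ \oo --> f x.
Proof.
move=> ux; have [M fM] := op_bounded f.
apply: (@norm_le_cvg0 _ (fun n => M * `|u n - x|)).
  by move=> n; rewrite -opB.
by rewrite -(mulr0 M); apply: cvgM; [exact: cvg_cst|exact: norm_sub_cvg].
Qed.

Lemma inner_cvg (u : nat -> H) x y :
  u @ \oo --> x -> (fun n => inner (u n) y) @ \oo --> inner x y.
Proof.
move=> ux; apply/cvgrPdist_lt => e e0.
have : (fun n => `|u n - x| * `|y|) @ \oo --> (0 : R).
  by rewrite -(mul0r `|y|); apply: cvgM; [exact: norm_sub_cvg|exact: cvg_cst].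
move/cvgrPdist_lt/(_ _ e0); apply: filterS => n.
rewrite sub0r normrN ger0_norm ?mulr_ge0 // => h.
by rewrite -innerBl; apply: le_lt_trans h; rewrite distrC cauchy_schwarz.
Qed.

Definition scvg (Y : nat -> BH) S := forall x, (fun n => Y n x) @ \oo --> S x.

(** Multiplication is jointly strongly continuous when the left factors are uniformly bounded;
    contractions are enough for the square root iteration. *)
Lemma scvgM (Y Z : nat -> BH) S T :
  (forall n x, `|Y n x| <= `|x|) -> scvg Y S -> scvg Z T ->
  scvg (fun n => Y n * Z n) (S * T).
Proof.
move=> Y1 YS ZT x.
apply: (@norm_le_cvg0 _ (fun n => `|Z n x - T x| + `|Y n (T x) - S (T x)|)).
  move=> n; rewrite !mul_opE.
  have -> : Y n (Z n x) - S (T x) = Y n (Z n x - T x) + (Y n (T x) - S (T x)).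
    by rewrite opB addrA subrK.
  by apply: (le_trans (ler_normD _ _)); rewrite lerD2r.
rewrite -(addr0 0); apply: cvgD; apply: norm_sub_cvg; [exact: ZT|exact: YS].
Qed.

Lemma scvg_unique (Y : nat -> BH) S T : scvg Y S -> scvg Y T -> S = T.
Proof. by move=> YS YT; apply: opP => x; apply: cvg_unique (YS x) (YT x). Qed.

(** The scalars [y n] increase and are bounded, hence converge; their increments dominate those of
    [Y n x], which is therefore a Cauchy sequence. *)
Lemma majorized_scvg (Y : nat -> BH) (y : nat -> R) :
  (forall n, y n <= 1) -> (forall n x, `|Y n x| <= `|x|) ->
  (forall n x, `|Y n.+1 x - Y n x| <= (y n.+1 - y n) * `|x|) ->
  exists S, scvg Y S.
Proof.
move=> y1 Y1 Yy.
(* Monotonicity of [y] is read off the norm bound at a nonzero vector, so the zero space is treated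
   apart. *)
have [[z z0]|H0] := pselect (exists z : H, z != 0); last first.
  exists 0 => x; have H0' w : w = 0 :> H.
    by apply/eqP; apply: contrapT => /negP w0; apply: H0; exists w.
  by under eq_fun => n do rewrite [Y n x]H0'; rewrite [_ x]H0'; exact: cvg_cst.
have ymono n : y n <= y n.+1.
  have := le_trans (normr_ge0 _) (Yy n z).
  by rewrite pmulr_lge0 ?normr_gt0 // subr_ge0.
have ynd : nondecreasing_seq y by apply/nondecreasing_seqP.
have yc : cvgn y.
  by apply: nondecreasing_is_cvgn => //; exists 1 => _ [n _ <-].
have Ynm n m x : (n <= m)%N -> `|Y m x - Y n x| <= (y m - y n) * `|x|.
  elim: m => [|m IH]; first by rewrite leqn0 => /eqP ->; rewrite !subrr normr0 mul0r.
  rewrite leq_eqVlt => /orP[/eqP ->|]; first by rewrite !subrr normr0 mul0r.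
  rewrite ltnS => /IH{}IH.
  have -> : Y m.+1 x - Y n x = (Y m.+1 x - Y m x) + (Y m x - Y n x).
    by rewrite addrA subrK.
  apply: (le_trans (ler_normD _ _)).
  by apply: (le_trans (lerD (Yy m x) IH)); rewrite -mulrDl addrA subrK.
have Yc x : cvg ((fun n => Y n x) @ \oo).
  apply: cauchy_cvg; apply: cauchy_exP => e e0.
  have e20 : 0 < e / (`|x| + 1) by rewrite divr_gt0 // ltr_wpDl.
  move/cvgrPdist_lt/(_ _ e20) : (yc) => [N _ NP].
  exists (Y N x); exists N => // n /= Nn.
  rewrite -ball_normE /= distrC; apply: (le_lt_trans (Ynm _ _ _ Nn)).
  have yn : y n - y N < e / (`|x| + 1).
    have := NP N (leqnn N); rewrite ger0_norm; last first.
      by rewrite subr_ge0; exact: nondecreasing_cvgn_le.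
    by apply: le_lt_trans; rewrite lerD2r; exact: nondecreasing_cvgn_le.
  have yn0 : 0 <= y n - y N by rewrite subr_ge0 ynd.
  rewrite ltr_pdivlMr ?ltr_wpDl // in yn.
  by apply: le_lt_trans yn; rewrite ler_wpM2l // lerDl.
have Lb : (fun x => lim ((fun n => Y n x) @ \oo)) \in @bounded_linear R H.
  apply/asboolP; split.
    move=> k u v; apply: cvg_lim => //.
    under eq_fun => n do rewrite op_linear.
    by apply: cvgD; [apply: cvgZr; exact: Yc|exact: Yc].
  exists 1 => x; rewrite mul1r.
  have /cvg_norm h := Yc x.
  rewrite -(cvg_lim _ h) //; apply: limr_le; first by apply/cvg_ex; eexists; exact: h.
  by apply: nearW => n; exact: Y1.
by exists (BoundedOp Lb) => x; exact: Yc.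
Qed.

(** * Square roots, positivity and polar decomposition *)

(* The iteration [Y' = (1 - T + Y^2) / 2] has fixed point [1 - sqrt T]; it is
   dominated in norm by the scalar iteration [y' = (1 + y^2) / 2]. *)
Lemma contraction_sqrt T :
  adjoint T = T -> (forall x, `|x - T x| <= `|x|) ->
  exists S, [/\ adjoint S = S, S * S = T &
    forall X : BH, GRing.comm X T -> GRing.comm X S].
Proof.
move=> Tsa T1.
have [Y [Y0 YS]] : exists Y : nat -> BH,
    Y 0%N = 0 /\ forall n, Y n.+1 = 2^-1 *: ((1 - T) + Y n * Y n).
  by exists (nat_rect (fun=> BH) 0 (fun _ Z => 2^-1 *: ((1 - T) + Z * Z))).
have [y [y0 yS]] : exists y : nat -> R,
    y 0%N = 0 /\ forall n, y n.+1 = 2^-1 * (1 + y n ^+ 2).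
  by exists (nat_rect (fun=> R) 0 (fun _ z => 2^-1 * (1 + z ^+ 2))).
(* Each [Y n] is a polynomial in [T]; in particular the iterates commute with one another. *)
have Ycomm (X : BH) n : GRing.comm X T -> GRing.comm X (Y n).
  move=> XT; elim: n => [|n IH]; first by rewrite Y0; exact: commr0.
  rewrite YS /GRing.comm scale_opMr scale_opMl; congr (_ *: _).
  apply: commrD; last exact: commrM.
  by apply: commrB => //; exact: commr1.
have Ysa n : adjoint (Y n) = Y n.
  elim: n => [|n IH]; first by rewrite Y0 linear0.
  by rewrite YS linearZ /= linearD linearB /= adjoint1 adjointM IH Tsa.
have y01 n : 0 <= y n <= 1.
  elim: n => [|n /andP[yn0 yn1]]; first by rewrite y0 lexx ler01.
  by rewrite yS; apply/andP; split; nra.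
have Yy n x : `|Y n x| <= y n * `|x|.
  elim: n x => [|n IH] x; first by rewrite Y0 y0 zero_opE normr0 mul0r.
  rewrite YS yS scale_opE normrZ ger0_norm ?invr_ge0 // -mulrA.
  rewrite ler_wpM2l ?invr_ge0 // add_opE mulrDl mul1r.
  apply: (le_trans (ler_normD _ _)); apply: lerD; first exact: T1.
  rewrite mul_opE; apply: (le_trans (IH _)); rewrite expr2 -mulrA.
  by rewrite ler_wpM2l //; case/andP: (y01 n).
have Y1 n x : `|Y n x| <= `|x|.
  apply: (le_trans (Yy n x)); rewrite -[leRHS]mul1r ler_wpM2r //.
  by case/andP: (y01 n).
have Yincr n x : `|Y n.+1 x - Y n x| <= (y n.+1 - y n) * `|x|.
  elim: n x => [|n IH] x; first by rewrite Y0 y0 zero_opE !subr0; exact: Yy.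
  have YY : GRing.comm (Y n.+1) (Y n) by apply/Ycomm/commr_sym/Ycomm.
  (* Difference of two squares of commuting operators; the same factorization of [y n.+2 - y n.+1]
     carries the domination to the next step. *)
  have -> : Y n.+2 x - Y n.+1 x
      = 2^-1 *: (Y n.+1 (Y n.+1 x - Y n x) + Y n (Y n.+1 x - Y n x)).
    rewrite [Y n.+2]YS {3}[Y n.+1]YS !scale_opE -scalerBr; congr (_ *: _).
    rewrite 2![in LHS]add_opE opprD addrACA subrr add0r !mul_opE !opB.
    by rewrite -[Y n.+1 (Y n x)]mul_opE YY mul_opE addrA subrK.
  rewrite normrZ ger0_norm ?invr_ge0 //.
  have -> : y n.+2 - y n.+1 = 2^-1 * ((y n.+1 + y n) * (y n.+1 - y n)).
    by rewrite [y n.+2]yS {2}yS; ring.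
  rewrite -!mulrA ler_wpM2l ?invr_ge0 //; apply: (le_trans (ler_normD _ _)).
  rewrite mulrDl; have [/andP[a0 _] /andP[b0 _]] := (y01 n.+1, y01 n).
  by apply: lerD; apply: (le_trans (Yy _ _)); rewrite ler_wpM2l.
have [L YL] : exists L, scvg Y L.
  by apply: (majorized_scvg (y := y)) => // n; case/andP: (y01 n).
have Lsa : adjoint L = L.
  apply: adjoint_unique => u v; rewrite [RHS]innerC.
  apply: cvg_unique (inner_cvg (y := v) (YL u)) _; first exact: Rhausdorff.
  rewrite (_ : (fun n => _) = (fun n => inner (Y n v) u)); first exact: inner_cvg.
  by apply/funext => n; rewrite adjointP Ysa innerC.
(* The recurrence passes to the strong limit; the resulting equation says that [1 - L] squares to
   [T]. *)
have LE : L = 2^-1 *: ((1 - T) + L * L).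
  apply: (@scvg_unique (fun n => Y n.+1)) => x.
    by have := YL x; rewrite -(cvg_shiftS (fun n => Y n x)).
  rewrite scale_opE add_opE; under eq_fun => n do rewrite YS scale_opE add_opE.
  apply: cvgZr; apply: cvgD; first exact: cvg_cst.
  exact: (scvgM Y1 YL YL).
exists (1 - L); split.
- by rewrite linearB /= adjoint1 Lsa.
- have {}LE : L + L = (1 - T) + L * L.
    rewrite [in LHS]LE -scalerDl (_ : 2^-1 + 2^-1 = 1 :> R) ?scale1r //.
    by field.
  rewrite mulrBl mul1r mulrBr mulr1 opprB addrA (addrAC (1 - L)); apply: (addIr (L + L)).
  by rewrite (addrAC (1 - L - L)) -(addrA 1) -opprD subrK LE addrA (addrC T) subrK.
- move=> X XT; apply: commrB; first exact: commr1.
  apply: (@scvg_unique (fun n => X * Y n)) => x; first by apply: op_cvg; exact: YL.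
  rewrite (_ : (fun n => _) = (fun n => Y n (X x))); first exact: YL.
  by apply/funext => n; rewrite (Ycomm X n XT).
Qed.

(** The usual argument for the semi-inner product defined by [T], which may be degenerate. *)
Lemma psd_cauchy_schwarz T x y :
  adjoint T = T -> (forall z, 0 <= inner (T z) z) ->
  inner (T x) y ^+ 2 <= inner (T x) x * inner (T y) y.
Proof.
move=> Tsa T0; set a := inner (T x) x; set b := inner (T x) y.
set c := inner (T y) y.
have c0 : 0 <= c := T0 y; have a0 : 0 <= a := T0 x.
have yx : inner (T y) x = b by rewrite adjointP Tsa innerC.
have q s t : 0 <= s ^+ 2 * a + 2 * (s * t * b) + t ^+ 2 * c.
  have := T0 (s *: x + t *: y).
  rewrite opD !opZ !(innerDl, innerDr, innerZl, innerZr) yx -/a -/b -/c.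
  by move/le_trans; apply; rewrite le_eqVlt; apply/orP; left; apply/eqP; ring.
have [c00|cn0] := eqVneq c 0.
  (* For [c = 0] this choice turns the form into [- b ^+ 2 * (a + 2)], which forces [b = 0]. *)
  have := q b (- (a + 1)); rewrite c00 mulr0 addr0 mulr0.
  have := sqr_ge0 b; nra.
have cp : 0 < c by rewrite lt_def cn0.
have := q c (- b).
rewrite (_ : _ + _ = c * (a * c - b ^+ 2)); last by ring.
by rewrite pmulr_rge0 // subr_ge0.
Qed.

(** Dividing [T] by a positive bound [c] of its norm makes [1 - c^-1 *: T] a contraction, so the
    iteration applies. *)
Lemma psd_sqrt T :
  adjoint T = T -> (forall x, 0 <= inner (T x) x) ->
  exists S, [/\ adjoint S = S, S * S = T &
    forall X : BH, GRing.comm X T -> GRing.comm X S].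
Proof.
move=> Tsa T0; have [M M0 TM] := op_bounded_ge0 T.
pose c := M + 1; have c0 : 0 < c by rewrite /c ltr_wpDl.
(* Cauchy-Schwarz for the form of [T] at [x] and [T x], divided by the squared norm of [T x]. *)
have TT x : inner (T x) (T x) <= c * inner (T x) x.
  have [->|Tx0] := eqVneq (T x) 0; first by rewrite !inner0l mulr0.
  have n0 : 0 < inner (T x) (T x) by rewrite inner_norm exprn_gt0 // normr_gt0.
  have := psd_cauchy_schwarz x (T x) Tsa T0.
  have h : inner (T (T x)) (T x) <= c * inner (T x) (T x).
    apply: (le_trans (ler_norm _)); apply: (le_trans (cauchy_schwarz _ _)).
    rewrite inner_norm expr2 mulrA ler_wpM2r //; apply: (le_trans (TM _)).
    by rewrite ler_wpM2r // lerDl.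
  rewrite expr2 => h'.
  rewrite -(ler_pM2r n0); apply: (le_trans h').
  by rewrite mulrAC mulrC ler_wpM2r.
have [||S [Ssa SS SX]] := @contraction_sqrt (c^-1 *: T).
- by rewrite linearZ /= Tsa.
- move=> x; rewrite scale_opE -(@ler_pXn2r _ 2) ?nnegrE // -!inner_norm.
  rewrite !(innerBl, innerBr, innerZl, innerZr) (innerC x).
  have cV : 0 < c^-1 by rewrite invr_gt0.
  have : c^-1 * inner (T x) (T x) <= inner (T x) x by rewrite ler_pdivrMl.
  have := T0 x; set a := inner (T x) x; set b := inner (T x) (T x).
  by move: c^-1 cV => d d0 a0 h; nra.
exists (Num.sqrt c *: S); split.
- by rewrite linearZ /= Ssa.
- rewrite scale_opMl scale_opMr SS !scalerA -expr2 sqr_sqrtr ?ltW //.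
  by rewrite divff ?scale1r // gt_eqF.
- move=> X XT; rewrite /GRing.comm scale_opMr scale_opMl SX //.
  by rewrite /GRing.comm scale_opMr scale_opMl XT.
Qed.

(** The square root gives the converse. Self-adjointness is stated separately because over the reals
    a nonnegative quadratic form does not imply it: a quarter turn of the plane has zero form. *)
Lemma positiveP T :
  positive T <-> adjoint T = T /\ forall x, 0 <= inner (T x) x.
Proof.
split=> [Tp|[Tsa T0]]; last first.
  by have [S [Ssa SS _]] := psd_sqrt Tsa T0; exists S; rewrite Ssa.
split=> [|x]; first exact: positive_selfadj.
by have [S ->] := Tp; rewrite mul_opE adjoint_inner inner_ge0.
Qed.

Lemma positive_sum (I : Type) (r : seq I) (P : pred I) (F : I -> BH) :
  (forall i, P i -> positive (F i)) -> positive (\sum_(i <- r | P i) F i).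
Proof.
move=> FP; apply/positiveP; split.
  rewrite linear_sum; apply: eq_bigr => i Pi; exact: positive_selfadj (FP i Pi).
move=> x; rewrite sum_opE inner_suml; apply: sumr_ge0 => i Pi.
by have /positiveP[_] := FP i Pi.
Qed.

Lemma polar_decomposition T :
  invertible T ->
  exists U P Q : BH, [/\ unitary U, T = U * P, Q * P = 1, P * Q = 1 &
    forall X : BH, GRing.comm X (adjoint T * T) -> GRing.comm X P].
Proof.
move=> [S [ST TS]].
have [_ T0] : _ /\ _ := proj1 (positiveP (adjoint T * T)) (ex_intro _ T erefl).
have Tsa : adjoint (adjoint T * T) = adjoint T * T by rewrite adjointM adjointK.
have [P [Psa PP PX]] := psd_sqrt Tsa T0.
have TS' : adjoint S * adjoint T = 1 by rewrite -adjointM TS adjoint1.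
have ST' : adjoint T * adjoint S = 1 by rewrite -adjointM ST adjoint1.
(* [S * adjoint S] inverts [adjoint T * T = P * P], so [P] has a left and a right inverse, and these
   agree. *)
pose Q := S * adjoint S * P.
have QP : Q * P = 1.
  by rewrite /Q -mulrA PP -!mulrA (mulrA (adjoint S)) TS' mul1r ST.
have PQ : P * Q = 1.
  have PQ' : P * (P * (S * adjoint S)) = 1.
    by rewrite mulrA PP -!mulrA (mulrA T) TS mul1r ST'.
  by rewrite -[Q]mulr1 -{1}PQ' (mulrA Q) QP mul1r.
clearbody Q.
have Qsa : adjoint Q = Q.
  by rewrite -[LHS]mulr1 -PQ mulrA -{1}Psa -adjointM PQ adjoint1 mul1r.
exists (T * Q), P, Q; split=> //; last by rewrite -mulrA QP mulr1.
apply: isometry_unitary.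
  rewrite adjointM Qsa -mulrA (mulrA (adjoint T)) -PP -!mulrA PQ mulr1.
  exact: QP.
exists (P * S); split.
  by rewrite -mulrA (mulrA S) ST mul1r PQ.
by rewrite -mulrA (mulrA Q) QP mul1r TS.
Qed.

End SquareRoot.

(** * Completely positive maps and the Kadison-Schwarz inequality *)

Section CompletelyPositiveMaps.
Context (R : realType) (A : realCStarAlgType R) (H : realHilbertType R).
Local Notation BH := (bounded_op H).
Implicit Types (Phi Psi : {linear A -> BH}) (T : BH).

Lemma cp_sum (I : finType) (P : pred I) (F : I -> {linear A -> BH}) Phi :
  (forall i, P i -> cp (F i)) -> (forall a, Phi a = \sum_(i | P i) F i a) ->
  cp Phi.
Proof.
move=> FP PhiE; split=> [a|n a T].
  rewrite !PhiE linear_sum; apply: eq_bigr => i Pi.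
  by have [Fsa _] := FP i Pi; rewrite Fsa.
under eq_bigr => i _ do under eq_bigr => k _ do
  rewrite PhiE mulr_sumr mulr_suml.
under eq_bigr => i _ do rewrite exchange_big /=.
rewrite exchange_big /=; apply: positive_sum => i Pi.
by have [_] := FP i Pi; apply.
Qed.

(** The conjugation is absorbed into the operator coefficients: [S i] becomes [T * S i]. *)
Lemma cp_Ad T Phi : cp Phi -> cp (Ad T \o Phi).
Proof.
move=> [Phisa Phicp]; split=> [a|n a S] /=.
  by rewrite Phisa adjoint_Ad.
have := Phicp n a (fun i => T * S i); congr positive.
apply: eq_bigr => i _; apply: eq_bigr => k _.
by rewrite adjointM /Ad !mulrA.
Qed.

(** Complete positivity for the algebra elements [cone], [a] with coefficients [- Phi a], [1]: the
    double sum collapses to [Phi (cmul (star a) a) - adjoint (Phi a) * Phi a]. *)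
Lemma kadison_schwarz Phi a x :
  ucp Phi -> inner (Phi a x) (Phi a x) <= inner (Phi (cmul (star a) a) x) x.
Proof.
move=> [[Phisa Phicp] Phi1].
have := Phicp 2%N (fun i => if i == 0 then cone else a)
                  (fun i => if i == 0 then - Phi a else 1).
rewrite !big_ord_recl !big_ord0 /= !star_cone !cmul1 cmulr1 Phi1 Phisa.
rewrite linearN /= adjoint1 !mulr1 !mul1r !addr0 !mulrN !mulNr opprK subrr add0r.
move=> /positiveP[_ /(_ x)].
by rewrite add_opE opp_opE mul_opE innerDl innerNl adjoint_inner; lra.
Qed.

(** * Extremality of pure maps *)

Lemma pure_cstar_extreme Phi : ucp Phi -> pure Phi -> cstar_extreme Phi.
Proof.
move=> Phiucp [_ Phipure]; split=> // n Phis T ucps Tinv T1 PhiE j.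
have cps k : cp (Ad (T k) \o Phis k) by apply: cp_Ad; case: (ucps k).
have [|t t01 tE] := Phipure _ (cps j).
  (* [Phi] minus its [j]-th summand is the sum of the other summands. *)
  apply: (@cp_sum _ (fun k => k != j) (fun k => Ad (T k) \o Phis k)) => //.
  by move=> a; rewrite /= PhiE (bigD1 j) //= addrAC subrr add0r.
have [S [ST TS]] := Tinv j.
have [_ Phi1] := Phiucp.
have TT : adjoint (T j) * T j = t *: (1 : BH) :> BH.
  have := tE cone; rewrite /= /Ad Phi1.
  by have [_ ->] := ucps j; rewrite mulr1.
(* Only a nonzero vector can exclude [t = 0]; on the zero space all operators coincide. *)
have [z0|H0] := pselect (exists z : H, z != 0); last first.
  have BH0 (X Y : BH) : X = Y.
    apply: opP => z; have w0 w : w = 0 :> H.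
      by apply/eqP; apply: contrapT => /negP wn0; apply: H0; exists w.
    by rewrite [LHS]w0 [RHS]w0.
  by exists 1 => [|a]; [split; exact: BH0|exact: BH0].
have t0 : 0 < t.
  case/andP: t01 => t0 _; rewrite lt_def t0 andbT; apply/eqP => t00.
  case: z0 => z /eqP; apply; rewrite -[z]one_opE -ST mul_opE.
  suff -> : T j z = 0 by rewrite op0.
  by apply: inner_eq0; rewrite adjointP -mul_opE TT t00 scale0r inner0r.
pose s := Num.sqrt t.
have s0 : s != 0 by rewrite gt_eqF // sqrtr_gt0.
have ss : s * s = t by rewrite -expr2 sqr_sqrtr // ltW.
pose U : BH := s^-1 *: T j.
have UV : U * (s *: S) = 1.
  by rewrite scale_opMl scale_opMr scalerA TS mulVf // scale1r.
have Uu : unitary U.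
  apply: isometry_unitary.
    rewrite linearZ /= scale_opMl scale_opMr TT !scalerA -ss.
    by rewrite [X in X *: _](_ : _ = 1) ?scale1r //; field.
  exists (s *: S); split=> //.
  by rewrite scale_opMl scale_opMr scalerA ST divff // scale1r.
have sU : s *: U = T j by rewrite scalerA divff // scale1r.
clearbody U.
(* After division by [t], [Phi] is the conjugate of [Phis j] by [U], and extremality asks for the
   inverse conjugation. *)
exists (adjoint U) => [|a]; first exact: unitary_adjoint.
have {}tE : Ad U (Phis j a) = Phi a.
  have := tE a; rewrite /= -sU /Ad linearZ /= !(scale_opMl, scale_opMr) scalerA ss.
  by move/(congr1 (fun X => t^-1 *: X)); rewrite !scalerA mulVf ?gt_eqF // !scale1r.
have [UU UU'] := Uu.
by rewrite -tE /Ad adjointK !mulrA UU' mul1r -mulrA UU' mulr1.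
Qed.

(** * Extremality of multiplicative maps *)

(* Equality in the Kadison-Schwarz inequalities for [Phi] forces each [T j] to
   intertwine [Phi] with the [j]-th summand. *)
Lemma star_hom_intertwining n (Phis : 'I_n -> {linear A -> BH})
    (T : 'I_n -> BH) Phi :
  star_hom Phi -> (forall j, ucp (Phis j)) ->
  \sum_j adjoint (T j) * T j = 1 ->
  (forall a, Phi a = \sum_j Ad (T j) (Phis j a)) ->
  forall j a, Phis j a * T j = T j * Phi a.
Proof.
move=> [PhiM Phisa] ucps T1 PhiE j a; apply: opP => x; rewrite !mul_opE.
have AdE X k u v : inner (Ad (T k) X u) v = inner (X (T k u)) (T k v).
  by rewrite /Ad !mul_opE adjoint_inner.
have sumPhi b u v : \sum_k inner (Phis k b (T k u)) (T k v) = inner (Phi b u) v.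
  rewrite PhiE sum_opE inner_suml; apply: eq_bigr => k _.
  by rewrite AdE.
have sum1 u v : \sum_k inner (T k u) (T k v) = inner u v.
  rewrite -[u in RHS]one_opE -T1 sum_opE inner_suml; apply: eq_bigr => k _.
  by rewrite mul_opE adjoint_inner.
pose d k := Phis k a (T k x) - T k (Phi a x).
(* Expand the squares and bound the first terms by Kadison-Schwarz. The three sums then become
   values of [Phi] at [x], and they cancel because [Phi] is multiplicative and preserves
   adjoints. *)
have d0 : \sum_k inner (d k) (d k) <= 0.
  have dE k : inner (d k) (d k) <= inner (Phis k (cmul (star a) a) (T k x)) (T k x)
      - 2 * inner (Phis k a (T k x)) (T k (Phi a x))
      + inner (T k (Phi a x)) (T k (Phi a x)).
    have := kadison_schwarz a (T k x) (ucps k).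
    rewrite /d !(innerBl, innerBr).
    by rewrite [inner (T k (Phi a x)) (Phis k a _)]innerC; lra.
  apply: (le_trans (ler_sum _ (fun k _ => dE k))).
  rewrite big_split /= big_split /= sumrN -mulr_sumr !sumPhi sum1.
  by rewrite PhiM Phisa mul_opE adjoint_inner; lra.
have : inner (d j) (d j) <= 0.
  apply: le_trans d0; rewrite (bigD1 j) //= lerDl sumr_ge0 // => k _.
  exact: inner_ge0.
have := inner_ge0 (d j) => dj0 dj1.
by apply/subr0_eq/inner_eq0/eqP; rewrite eq_le dj1 dj0.
Qed.

Lemma star_hom_cstar_extreme Phi : ucp Phi -> star_hom Phi -> cstar_extreme Phi.
Proof.
move=> Phiucp Phihom; split=> // n Phis T ucps Tinv T1 PhiE j.
have PhiT := star_hom_intertwining Phihom ucps T1 PhiE j.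
have [_ Phisa] := Phihom.
have [U [P [Q [Uu TUP QP PQ PX]]]] := polar_decomposition (Tinv j).
have PhiP a : GRing.comm (Phi a) P.
  apply: PX; rewrite /GRing.comm.
  have [[sa _] _] := ucps j.
  (* The adjoint of the intertwining relation at [star a]; with the relation at [a] it makes [Phi a]
     commute with [adjoint (T j) * T j]. *)
  have h : adjoint (T j) * Phis j a = Phi a * adjoint (T j).
    have := congr1 (@adjoint R H) (PhiT (star a)).
    by rewrite !adjointM sa Phisa !adjointK.
  by rewrite mulrA -h -mulrA PhiT mulrA.
exists (adjoint U) => [|a]; first exact: unitary_adjoint.
have [UU UU'] := Uu.
rewrite /Ad adjointK.
(* Moving [P] past [Phi a] puts it on the right of both sides, where [Q] cancels it; what remains is
   the intertwining by [U]. *)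
have := PhiT a; rewrite TUP -[U * P * Phi a]mulrA -PhiP => h.
have := congr1 (fun X => X * (Q * adjoint U)) h.
by rewrite -!mulrA (mulrA P) PQ mul1r UU' mulr1.
Qed.

End CompletelyPositiveMaps.

Theorem corollary3p10 (R : realType) (A : realCStarAlgType R)
    (H : realHilbertType R) (Phi : {linear A -> bounded_op H}) :
  ucp Phi -> pure Phi \/ star_hom Phi -> cstar_extreme Phi.
Proof.
by move=> Phiucp [|]; [exact: pure_cstar_extreme|exact: star_hom_cstar_extreme].
Qed.
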